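(* Let $\Lambda=(\lambda_n)_{n\ge 1}$ be a non-decreasing sequence of positive reals tending to infinity with $\lambda_1=1$ and $\lambda_{n+1}\le\lambda_n+1$. For any Orlicz function $M$ and any sequence $p=(p_k)$ of strictly positive real numbers, the sets $[V,\lambda,M,\widehat F,p]_0^G$, $[V,\lambda,M,\widehat F,p]^G$ and $[V,\lambda,M,\widehat F,p]_\infty^G$ are linear spaces over the field $\mathbb C(G)$ of geometric complex numbers (with respect to termwise geometric addition $\oplus$ and geometric scalar multiplication $\odot$).
   Context: An Orlicz function is a continuous, convex, non-decreasing function $M:[0,\infty)\to[0,\infty)$ with $M(0)=0$ and $M(x)>0$ for $x>0$. $I_n$ is the set of integers $k$ with $n-\lambda_n+1\le k\le n$. The Fibonacci numbers are $f_0=f_1=1$, $f_n=f_{n-1}+f_{n-2}$ for $n\ge2$. Geometric arithmetic: $\mathbb C(G)=\{e^z:z\in\mathbb C\}$, where elements are handled through their exponents ($e^z$ and $e^w$ are the same element iff $z=w$), with $e^z\oplus e^w=e^{z+w}$, $e^z\ominus e^w=e^{z-w}$, $e^z\odot e^w=e^{zw}$; this is a field with zero $1=e^0$ and identity $e=e^1$. The geometric modulus is $|e^z|_G=e^{|z|}$. In the definitions below all arithmetic is geometric: for real $c$, $c\,e^z$ means $e^{cz}$; for $a\ge0$ and $\rho=e^r>1$, $e^a/\rho$ means $e^{a/r}$; $M(e^a)$ means $e^{M(a)}$; $(e^a)^{p^G}$ means $e^{a^p}$; $G\sum_k e^{a_k}=e^{\sum_k a_k}$; $G\lim_n e^{a_n}=e^{\lim_n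 a_n}$. $\omega(G)$ is the set of all sequences $x=(x_k)_{k\ge0}$ in $\mathbb C(G)$. For $x\in\omega(G)$ and $k\ge1$ put $y_k=\frac{f_k}{f_{k+1}}x_k\ominus\frac{f_{k+1}}{f_k}x_{k-1}$. Define $[V,\lambda,M,\widehat F,p]_0^G=\{x\in\omega(G): G\lim_{n}\frac1{\lambda_n}G\sum_{k\in I_n}[M(|y_k|_G/\rho)]^{p_k^G}=1\text{ for some }\rho>1\}$, $[V,\lambda,M,\widehat F,p]^G=\{x\in\omega(G): G\lim_{n}\frac1{\lambda_n}G\sum_{k\in I_n}[M(|y_k\ominus\ell|_G/\rho)]^{p_k^G}=1\text{ for some }\ell\in\mathbb C(G),\ \rho>1\}$, $[V,\lambda,M,\widehat F,p]_\infty^G=\{x\in\omega(G): \sup_{n}\frac1{\lambda_n}G\sum_{k\in I_n}[M(|y_k|_G/\rho)]^{p_k^G}<\infty\text{ for some }\rho>1\}$. Equivalently, in exponents: writing $x_k=e^{z_k}$, $w_k=\frac{f_k}{f_{k+1}}z_k-\frac{f_{k+1}}{f_k}z_{k-1}$, $\rho=e^r$ with $r>0$, $\ell=e^{L}$, the three conditions say respectively $\frac1{\lambda_n}\sum_{k\in I_n}M(|w_k|/r)^{p_k}\to0$; $\frac1{\lambda_n}\sum_{k\in I_n}M(|w_k-L|/r)^{p_k}\to0$; $\sup_n\frac1{\lambda_n}\sum_{k\in I_n}M(|w_k|/r)^{p_k}<\infty$. *)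

(* Defs.v *)
From HB Require Import structures.
From mathcomp Require Import all_boot all_order all_algebra.
From mathcomp Require Import complex.
From mathcomp Require Import all_classical all_reals all_analysis.

Set Implicit Arguments.
Unset Strict Implicit.
Unset Printing Implicit Defensive.

Import Order.TTheory GRing.Theory Num.Theory.
Import numFieldNormedType.Exports.

Local Open Scope classical_set_scope.
Local Open Scope ring_scope.

(* [Gexp z] is the geometric number e^z, which is identified by its exponent
   (e^z and e^w are the same element iff z = w), whence a wrapper around K
   rather than the image of an exponential map. *)
Record geo (K : Type) : Type := Gexp { glog : K }.

Section GeoField.
Variable K : fieldType.
Implicit Types x y : geo K.

HB.instance Definition _ := [isNew for @glog K].
HB.instance Definition _ := [Choice of geo K by <:].

Lemma glog_inj : injective (@glog K).
Proof. exact: val_inj. Qed.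

Definition gadd x y := Gexp (glog x + glog y).
Definition gopp x := Gexp (- glog x).
Definition gmul x y := Gexp (glog x * glog y).
Definition ginv x := Gexp (glog x)^-1.

Fact gaddA : associative gadd.
Proof. by move=> x y z; apply: glog_inj; rewrite /= addrA. Qed.
Fact gaddC : commutative gadd.
Proof. by move=> x y; apply: glog_inj; rewrite /= addrC. Qed.
Fact gadd0 : left_id (Gexp 0) gadd.
Proof. by move=> x; apply: glog_inj; rewrite /= add0r. Qed.
Fact gaddN : left_inverse (Gexp 0) gopp gadd.
Proof. by move=> x; apply: glog_inj; rewrite /= addNr. Qed.

HB.instance Definition _ :=
  GRing.isZmodule.Build (geo K) gaddA gaddC gadd0 gaddN.

Fact gmulA : associative gmul.
Proof. by move=> x y z; apply: glog_inj; rewrite /= mulrA. Qed.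
Fact gmulC : commutative gmul.
Proof. by move=> x y; apply: glog_inj; rewrite /= mulrC. Qed.
Fact gmul1 : left_id (Gexp 1) gmul.
Proof. by move=> x; apply: glog_inj; rewrite /= mul1r. Qed.
Fact gmulDl : left_distributive gmul gadd.
Proof. by move=> x y z; apply: glog_inj; rewrite /= mulrDl. Qed.
Fact gone_neq0 : Gexp 1 != 0 :> geo K.
Proof. by apply/eqP => -[] /eqP; rewrite oner_eq0. Qed.

HB.instance Definition _ := GRing.Zmodule_isComNzRing.Build (geo K)
  gmulA gmulC gmul1 gmulDl gone_neq0.

Fact gmulVx x : x != 0 -> ginv x * x = 1.
Proof.
by move=> x0; apply: glog_inj; rewrite /= mulVf.
Qed.
Fact ginv0 : ginv 0 = 0.
Proof. by apply: glog_inj; rewrite /= invr0. Qed.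

HB.instance Definition _ := GRing.ComNzRing_isField.Build (geo K) gmulVx ginv0.

Definition gscale (c : K) x : geo K := Gexp (c * glog x).

End GeoField.

Definition geoC (R : realType) : fieldType := geo R[i].
Definition geoR (R : realType) : fieldType := geo R.

(* Sequences with the termwise geometric operations; ^o makes geoC R a
   vector space over itself. *)
Definition omegaG (R : realType) : lmodType (geoC R) := nat -> (geoC R)^o.


Section GeometricReals.
Variable R : realType.

Definition gmod (x : geoC R) : geoR R := Gexp (Normc.normc (glog x)).

(* Ordinary order of the positive reals e^a < e^b, i.e. a < b. *)
Definition glt (a b : geoR R) : Prop := glog a < glog b.

Definition gpow (a : geoR R) (p : R) : geoR R := Gexp (glog a `^ p).

Definition gfun (M : R -> R) (a : geoR R) : geoR R := Gexp (M (glog a)).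

Definition Glim (u : nat -> geoR R) (l : geoR R) : Prop :=
  (fun n => glog (u n)) @ \oo --> glog l.

(* sup_n e^{a_n} < oo over n >= 1, i.e. sup_n a_n < +oo. *)
Definition Gsup_finite (u : nat -> geoR R) : Prop :=
  (ereal_sup [set (glog (u n))%:E | n in [set n | (1 <= n)%N]] < +oo)%E.

End GeometricReals.

(* M stands for its restriction to [0, +oo[, the only part ever used;
   M >= 0 there follows from the last two clauses. *)
Definition orlicz (R : realType) (M : R -> R) : Prop :=
  [/\ {within `[0, +oo[, continuous M},
      convex_function (`[0, +oo[%classic : set R^o) M,
      {in `[0, +oo[ &, {homo M : x y / x <= y}},
      M 0 = 0 &
      forall x, 0 < x -> 0 < M x].

Fixpoint fib (n : nat) : nat :=
  match n with
  | 0 => 1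
  | n'.+1 => match n' with 0 => 1 | n''.+1 => fib n' + fib n'' end
  end%N.

(* lambda is indexed by n >= 1; the value lambda 0 is never constrained. *)
Definition lambda_seq (R : realType) (lambda : nat -> R) : Prop :=
  [/\ (forall n, (1 <= n)%N -> 0 < lambda n),
      (forall m n, (1 <= m)%N -> (m <= n)%N -> lambda m <= lambda n),
      lambda @ \oo --> +oo,
      lambda 1%N = 1 &
      (forall n, (1 <= n)%N -> lambda n.+1 <= lambda n + 1)].

Section SequenceSpaces.
Variables (R : realType) (lambda : nat -> R) (M : R -> R) (p : nat -> R).
Implicit Types x : omegaG R.

(* For n >= 1 one has lambda n <= n, so that n - lambda n + 1 >= 1 and the
   integers of I_n all lie in {1, ..., n}. *)
Definition Iseg (n : nat) : seq nat :=
  [seq k <- iota 0 n.+1 | n%:R - lambda n + 1 <= k%:R].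

(* Only used at k >= 1. *)
Definition Fhat x (k : nat) : geoC R :=
  gscale ((fib k)%:R / (fib k.+1)%:R) (x k)
  - gscale ((fib k.+1)%:R / (fib k)%:R) (x k.-1).

(* 1/lambda_n G-sum_(k in I_n) [M(|y_k|_G / rho)]^(p_k^G); the sum and the
   quotient by rho are those of the field geoR R. *)
Definition Vmean (rho : geoR R) (y : nat -> geoC R) (n : nat) : geoR R :=
  gscale (lambda n)^-1
    (\sum_(k <- Iseg n) gpow (gfun M (gmod (y k) / rho)) (p k)).

(* The real number 1 = e^0 is the zero of the field geoR R, so rho > 1 is
   glt 0 rho and a geometric limit equal to 1 is a Glim to 0. *)
Definition V0G : set (omegaG R) :=
  [set x | exists2 rho : geoR R, glt 0 rho & Glim (Vmean rho (Fhat x)) 0].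

Definition VG : set (omegaG R) :=
  [set x | exists (ell : geoC R) (rho : geoR R),
     glt 0 rho /\ Glim (Vmean rho (fun k => Fhat x k - ell)) 0].

Definition VinftyG : set (omegaG R) :=
  [set x | exists2 rho : geoR R, glt 0 rho & Gsup_finite (Vmean rho (Fhat x))].

End SequenceSpaces.

(* Main.v *)
(** With r = |a| r1 + r2, the mediant inequality bounds |a y + z| / r by
    max (|y| / r1, |z| / r2).  As M and powers are monotone,
    M(|a y + z| / r)^p is at most the maximum, a fortiori the sum, of
    M(|y| / r1)^p and M(|z| / r2)^p, whatever the exponent p > 0. *)
Require Import Defs.
From HB Require Import structures.
From mathcomp Require Import all_boot all_order all_algebra.
From mathcomp Require Import complex.
From mathcomp Require Import all_classical all_reals all_analysis.
Import Order.TTheory GRing.Theory Num.Theory.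
Import numFieldNormedType.Exports.
Local Open Scope ring_scope.

Set Implicit Arguments.
Unset Strict Implicit.

(** Passes from the boolean predicate [[in A]] to propositional membership, so that each space needs
    only its zero and the combinations [a *: u + v]. *)
Lemma submod_closed_in (K : pzRingType) (V : lmodType K) (A : set V) :
  A 0 -> (forall (a : K) (u v : V), A u -> A v -> A (a *: u + v)) ->
  GRing.submod_closed [in A].
Proof.
move=> A0 AD; split=> [|a u v /set_mem Au /set_mem Av]; apply/mem_set => //.
exact: AD.
Qed.

Lemma glog_sum (K : fieldType) (I : Type) (s : seq I) (F : I -> geo K) :
  glog (\sum_(i <- s) F i) = \sum_(i <- s) glog (F i).
Proof. exact: (big_morph (@glog K)). Qed.

Lemma normc_ge0 (R : realType) (z : R[i]) : 0 <= Normc.normc z.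
Proof. by case: z => ? ?; exact: sqrtr_ge0. Qed.

(** With [m] the maximum, [x <= m * r1] and [y <= m * r2]; combine these with weights [a] and 1. *)
Lemma mediant_le_max (R : realFieldType) (a x y r1 r2 : R) :
  0 <= a -> 0 < r1 -> 0 < r2 ->
  (a * x + y) / (a * r1 + r2) <= Num.max (x / r1) (y / r2).
Proof.
move=> a0 r10 r20.
rewrite ler_pdivrMr; last by rewrite ltr_wpDl// mulr_ge0// ltW.
rewrite mulrDr (mulrCA _ a) lerD//; first rewrite ler_wpM2l//.
  by rewrite -ler_pdivrMr// le_max lexx.
by rewrite -ler_pdivrMr// le_max lexx orbT.
Qed.

Lemma Fhat_linear (R : realType) (a : geoC R) (u v : omegaG R) (k : nat) :
  Fhat (a *: u + v) k = a * Fhat u k + Fhat v k.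
Proof.
apply: glog_inj => /=.
rewrite /= !mulrDr !(mulrCA _ (glog a)) opprD mulrN.
by rewrite addrACA.
Qed.

Lemma Fhat0 (R : realType) (k : nat) : Fhat (0 : omegaG R) k = 0.
Proof. by apply: glog_inj; rewrite /= !mulr0 subr0. Qed.

Section VmeanTheory.
Context {R : realType} (lambda : nat -> R) (M : R -> R) (p : nat -> R).
Hypotheses (lambdaP : lambda_seq lambda) (MP : orlicz M).
Hypothesis p_gt0 : forall k : nat, (1 <= k)%N -> 0 < p k.

Let Mge0 x : 0 <= x -> 0 <= M x.
Proof.
case: MP => _ _ Mhomo M0 _ x0.
by rewrite -M0 Mhomo// in_itv/= andbT.
Qed.

(** Induction from [lambda 1 = 1], with increments at most 1. *)
Lemma lambda_le (n : nat) : (1 <= n)%N -> lambda n <= n%:R.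
Proof.
case: lambdaP => _ _ _ l1 lS; case: n => // n _.
elim: n => [|n IHn]; first by rewrite l1.
by rewrite (le_trans (lS _ _))// -[in leRHS]natr1 lerD2r.
Qed.

(** An index 0 would force [n < lambda n]. Hence [p k > 0], assumed only for [k >= 1], is available
    on all of I_n. *)
Lemma Iseg_gt0 (n k : nat) : (1 <= n)%N -> k \in Iseg lambda n -> (1 <= k)%N.
Proof.
move=> n1; rewrite mem_filter => /andP[+ _]; case: k => // /le_lt_trans.
move=> /(_ 1 ltr01); rewrite -ltrBrDr subrr subr_lt0.
by rewrite ltNge lambda_le.
Qed.

Lemma glog_Vmean (rho : geoR R) (y : nat -> geoC R) (n : nat) :
  glog (Vmean lambda M p rho y n) =
  (lambda n)^-1 *
    \sum_(k <- Iseg lambda n) M (Normc.normc (glog (y k)) / glog rho) `^ p k.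
Proof. by rewrite /= glog_sum. Qed.

Lemma Vmean_ge0 (rho : geoR R) (y : nat -> geoC R) (n : nat) :
  (1 <= n)%N -> 0 <= glog (Vmean lambda M p rho y n).
Proof.
case: lambdaP => l0 _ _ _ _ n1.
rewrite glog_Vmean mulr_ge0 ?invr_ge0//; first by rewrite ltW ?l0.
by apply: sumr_ge0 => k _; exact: powR_ge0.
Qed.

Lemma Vmean0 (rho : geoR R) (y : nat -> geoC R) (n : nat) :
  (1 <= n)%N -> (forall k, y k = 0) -> glog (Vmean lambda M p rho y n) = 0.
Proof.
case: MP => _ _ _ M0 _ n1 y0; rewrite glog_Vmean big_seq big1 ?mulr0// => k.
(* A zero base gives 0 only for a nonzero exponent, since 0 to the power 0 is 1. *)
move=> /(Iseg_gt0 n1) k1; rewrite y0 Normc.normc0 mul0r M0 powR0//.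
by rewrite gt_eqF ?p_gt0.
Qed.

(** The new [rho] is chosen before the sequences and [n], so one bound serves limits and suprema
    alike, and also the sequences shifted by some [ell]. *)
Lemma Vmean_comb_le (a : geoC R) (rho1 rho2 : geoR R) :
  glt 0 rho1 -> glt 0 rho2 ->
  exists2 rho : geoR R, glt 0 rho &
    forall (w y z : nat -> geoC R) (n : nat),
      (forall k, w k = a * y k + z k) -> (1 <= n)%N ->
      glog (Vmean lambda M p rho w n) <=
      glog (Vmean lambda M p rho1 y n) + glog (Vmean lambda M p rho2 z n).
Proof.
case: rho1 rho2 => [r1] [r2] r10 r20; rewrite /glt /= in r10 r20.
have a0 := normc_ge0 (glog a).
(* The summand [r2] keeps this positive even when [a] is zero. *)
have r0 : 0 < Normc.normc (glog a) * r1 + r2.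
  by rewrite ltr_wpDl// mulr_ge0// ltW.
exists (Gexp (Normc.normc (glog a) * r1 + r2)) => // w y z n wE n1.
case: MP => _ _ Mhomo _ _; case: lambdaP => l0 _ _ _ _.
rewrite !glog_Vmean /= -mulrDr ler_wpM2l ?invr_ge0//; first by rewrite ltW ?l0.
rewrite -big_split/= big_seq [leRHS]big_seq; apply: ler_sum => k.
move=> /(Iseg_gt0 n1) k1; rewrite wE.
set x := Normc.normc _ / _; set x1 := _ / r1; set x2 := _ / r2.
have x0 : 0 <= x by rewrite divr_ge0 ?normc_ge0 ?ltW.
have x10 : 0 <= x1 by rewrite divr_ge0 ?normc_ge0 ?ltW.
have x20 : 0 <= x2 by rewrite divr_ge0 ?normc_ge0 ?ltW.
(* The triangle inequality and multiplicativity of the modulus bring the numerator to mediant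
   form. *)
have : x <= Num.max x1 x2.
  apply: le_trans (mediant_le_max _ _ a0 r10 r20).
  rewrite ler_wpM2r ?invr_ge0 ?(ltW r0)// -Normc.normcM.
  exact: (@le_normcD R (glog a * glog (y k)) (glog (z k))).
have powM u : 0 <= u -> x <= u -> M x `^ p k <= M u `^ p k.
  move=> u0 xu; apply: ge0_ler_powR; rewrite ?nnegrE ?Mge0 ?(ltW (p_gt0 _))//.
  by apply: Mhomo; rewrite ?in_itv/= ?andbT.
rewrite le_max => /orP[] xu.
  by rewrite (le_trans (powM _ _ xu))// lerDl powR_ge0.
by rewrite (le_trans (powM _ _ xu))// lerDr powR_ge0.
Qed.

Lemma Glim_Vmean0 (rho : geoR R) (y : nat -> geoC R) :
  (forall k, y k = 0) -> Glim (Vmean lambda M p rho y) 0.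
Proof.
(* The mean is known to vanish only from [n = 1] on, which is enough for a limit. *)
move=> y0; rewrite /Glim; apply: cvg_near_cst; near=> n.
by rewrite Vmean0//; near: n; exists 1%N.
Unshelve. all: by end_near. Qed.

Lemma Glim_Vmean_comb (a : geoC R) (rho1 rho2 : geoR R)
    (w y z : nat -> geoC R) :
  glt 0 rho1 -> glt 0 rho2 -> (forall k, w k = a * y k + z k) ->
  Glim (Vmean lambda M p rho1 y) 0 -> Glim (Vmean lambda M p rho2 z) 0 ->
  exists2 rho : geoR R, glt 0 rho & Glim (Vmean lambda M p rho w) 0.
Proof.
move=> r10 r20 wE ylim zlim.
have [rho r0 le_rho] := Vmean_comb_le a r10 r20.
exists rho => //; have /(_ _) yzlim := cvgD ylim zlim; rewrite addr0 in yzlim.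
(* For [n >= 1] the mean lies between 0 and a sum of two means tending to 0. *)
rewrite /Glim; apply: (squeeze_cvgr _ (cvg_cst _) yzlim); near=> n.
have n1 : (1 <= n)%N by near: n; exists 1%N.
by rewrite Vmean_ge0//= le_rho.
Unshelve. all: by end_near. Qed.

Lemma V0G_submod_closed : GRing.submod_closed [in V0G lambda M p].
Proof.
apply: submod_closed_in => [|a u v].
  by exists (Gexp 1); [exact: ltr01 | exact: Glim_Vmean0 (@Fhat0 R)].
move=> [rho1 r10 ulim] [rho2 r20 vlim].
exact: Glim_Vmean_comb r10 r20 (Fhat_linear a u v) ulim vlim.
Qed.

Lemma VG_submod_closed : GRing.submod_closed [in VG lambda M p].
Proof.
apply: submod_closed_in => [|a u v].
  exists 0, (Gexp 1); split; first exact: ltr01.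
  by apply: Glim_Vmean0 => k; rewrite Fhat0 subr0.
move=> [l1 [rho1 [r10 ulim]]] [l2 [rho2 [r20 vlim]]].
(* The combination has limit [a * l1 + l2]: centring there gives the same combination of the two
   centred sequences. *)
have wE k : Fhat (a *: u + v) k - (a * l1 + l2)
    = a * (Fhat u k - l1) + (Fhat v k - l2).
  rewrite Fhat_linear; move: (Fhat u k) (Fhat v k) => y z.
  by rewrite mulrBr opprD addrACA.
have [rho r0 lim] := Glim_Vmean_comb r10 r20 wE ulim vlim.
by exists (a * l1 + l2), rho.
Qed.

Lemma VinftyG_submod_closed : GRing.submod_closed [in VinftyG lambda M p].
Proof.
apply: submod_closed_in => [|a u v].
  exists (Gexp 1); first exact: ltr01.
  apply: le_lt_trans (ltry 0); apply: ge_ereal_sup => _ [n n1 <-].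
  by rewrite Vmean0// => k; exact: Fhat0.
move=> [rho1 r10 usup] [rho2 r20 vsup].
have [rho r0 le_rho] := Vmean_comb_le a r10 r20.
(* The sum of the two finite suprema bounds every mean of the combination. *)
exists rho => //; apply: le_lt_trans (lte_add_pinfty usup vsup).
apply: ge_ereal_sup => _ [n n1 <-].
have := le_rho _ _ _ _ (Fhat_linear a u v) n1.
rewrite -lee_fin EFinD => /le_trans; apply.
by apply: leeD; apply: ereal_sup_ubound; exists n.
Qed.

End VmeanTheory.

Theorem theorem3p1 (R : realType) (lambda : nat -> R) (M : R -> R)
    (p : nat -> R) (lambdaP : lambda_seq lambda) (MP : orlicz M)
    (p_gt0 : forall k : nat, (1 <= k)%N -> 0 < p k) :
  [/\ GRing.submod_closed [in V0G lambda M p],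
      GRing.submod_closed [in VG lambda M p] &
      GRing.submod_closed [in VinftyG lambda M p]].
Proof.
split.
- exact: V0G_submod_closed.
- exact: VG_submod_closed.
- exact: VinftyG_submod_closed.
Qed.
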